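(* Let $G$ be a finite simple graph and $S\subseteq V(G)$. Then $\det(G|_S)=1$ if and only if there exists a sequence of pivots $\varphi$ with $\sup(\varphi)=S$ that is applicable to $G$; moreover, in that case such a $\varphi$ can be chosen to be reduced.
   Context: $G|_S$ is the induced subgraph; $\det H$ is the determinant over $GF(2)$ of the adjacency matrix of $H$ (empty determinant $=1$). For a vertex $x$, $N'(x)=N(x)\cup\{x\}$. Pivot: for an edge $\{u,v\}$, let $V_1=N'(u)\setminus N'(v)$, $V_2=N'(v)\setminus N'(u)$, $V_3=N'(u)\cap N'(v)$; $G[uv]$ is obtained by toggling every pair $\{x,y\}$ with $x\in V_i$, $y\in V_j$, $i\neq j$. A sequence $[v_1v_2]\cdots[v_{n-1}v_n]$ is applicable to $G$ if each $\{v_i,v_{i+1}\}$ is an edge of the graph obtained by applying the preceding pivots. The support $\sup(\varphi)=\{v_1\}\oplus\cdots\oplus\{v_n\}$ is the set of vertices occurring an odd number of times. A sequence is reduced if no vertex occurs more than once in it. *)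

(* Defs.v *)
From HB Require Import structures.
From mathcomp Require Import all_boot all_order all_algebra.

Set Implicit Arguments.
Unset Strict Implicit.
Unset Printing Implicit Defensive.

Import GRing.Theory.
Local Open Scope ring_scope.

Record sgraph (V : finType) := SGraph {
  edge : rel V;
  edge_sym : symmetric edge;
  edge_irr : irreflexive edge
}.

Section Graph.
Variable V : finType.
Implicit Types (G : sgraph V) (x y u v : V) (S : {set V}).

Lemma induced_sym G S :
  symmetric (fun x y : {x : V | x \in S} => edge G (val x) (val y)).
Proof. by move=> x y; apply: edge_sym. Qed.

Lemma induced_irr G S :
  irreflexive (fun x y : {x : V | x \in S} => edge G (val x) (val y)).
Proof. by move=> x; apply: edge_irr. Qed.

Definition induced G S : sgraph {x : V | x \in S} :=
  SGraph (@induced_sym G S) (@induced_irr G S).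

(* Rows and columns are numbered by the enumeration of V; the determinant does
   not depend on this numbering. *)
Definition adjmx G : 'M['F_2]_#|V| :=
  \matrix_(i, j) (edge G (enum_val i) (enum_val j))%:R.

(* For an empty V this is the determinant of a 0 x 0 matrix, which is 1. *)
Definition gdet G : 'F_2 := \det (adjmx G).

Definition nbhd G x : {set V} := [set y | edge G x y].
Definition cl_nbhd G x : {set V} := x |: nbhd G x.

(* The classes V_1, V_2, V_3 are indexed by 0, 1, 2 : 'I_3. *)
Definition pivot_class G u v (i : 'I_3) : {set V} :=
  tnth [tuple cl_nbhd G u :\: cl_nbhd G v;
              cl_nbhd G v :\: cl_nbhd G u;
              cl_nbhd G u :&: cl_nbhd G v] i.

Definition toggled G u v x y : bool :=
  [exists i, exists j,
    [&& i != j, x \in pivot_class G u v i & y \in pivot_class G u v j]].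

Definition pivot_edge G u v : rel V :=
  fun x y => edge G x y (+) toggled G u v x y.

Lemma toggled_sym G u v : symmetric (toggled G u v).
Proof.
move=> x y; apply/existsP/existsP => -[i /existsP[j /and3P[ij xi yj]]];
  by exists j; apply/existsP; exists i; rewrite eq_sym ij yj xi.
Qed.

Lemma pivot_sym G u v : symmetric (pivot_edge G u v).
Proof. by move=> x y; rewrite /pivot_edge edge_sym toggled_sym. Qed.

Lemma pivot_class_disj G u v x i j :
  x \in pivot_class G u v i -> x \in pivot_class G u v j -> i = j.
Proof.
case: i j => [[|[|[|//]]] hi] [[|[|[|//]]] hj];
  rewrite /pivot_class !(tnth_nth set0) /= !(in_setD, in_setI);
  case: (x \in cl_nbhd G u) (x \in cl_nbhd G v) => [] [] //= _ _;
  exact: val_inj.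
Qed.

Lemma pivot_irr G u v : irreflexive (pivot_edge G u v).
Proof.
move=> x; rewrite /pivot_edge edge_irr /=; apply/negbTE/negP.
move=> /existsP[i /existsP[j /and3P[/eqP ij xi xj]]].
exact/ij/(pivot_class_disj xi xj).
Qed.

(* G[uv]; total in u and v, but used only when {u, v} is an edge of G. *)
Definition pivot G u v : sgraph V :=
  SGraph (pivot_sym G u v) (pivot_irr G u v).

(* A sequence of pivots [v_1 v_2] ... [v_(n-1) v_n] is the list of its pairs,
   applied from left to right; it may be empty. *)
Fixpoint applicable G (phi : seq (V * V)) : bool :=
  if phi is p :: phi' then
    edge G p.1 p.2 && applicable (pivot G p.1 p.2) phi'
  else true.

Definition pivot_vertices (phi : seq (V * V)) : seq V :=
  flatten [seq [:: p.1; p.2] | p <- phi].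

Definition pivot_support (phi : seq (V * V)) : {set V} :=
  [set x | odd (count_mem x (pivot_vertices phi))].

Definition reduced (phi : seq (V * V)) : bool := uniq (pivot_vertices phi).

End Graph.

(* Main.v *)
(* Let A be the adjacency matrix of G over GF(2). G|_S is nonsingular iff the
   space {(f, A f)} meets trivially the coordinate subspace "f = 0 off S and
   A f = 0 on S". For an edge uv, the pivot exchanges the coordinates f and A f
   at u and v, so G[uv]|_T is nonsingular iff G|_(T (+) {u,v}) is. A sequence
   of pivots with support S thus links G|_S to the empty induced subgraph.
   Conversely, if G|_S is nonsingular and S is nonempty, then S contains an
   edge uv, and G[uv] restricted to S \ {u,v} is again nonsingular. *)
Require Import Defs.
From mathcomp Require Import all_boot all_order all_algebra.
Import GRing.Theory.
Local Open Scope ring_scope.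

Set Implicit Arguments.
Unset Strict Implicit.
Unset Printing Implicit Defensive.

Lemma F2_cases (a : 'F_2) : a = 0 \/ a = 1.
Proof.
by case: a => [[|[|//]]] ha; [left | right]; apply: val_inj.
Qed.

Lemma F2_addb (a b : bool) : (a (+) b)%:R = a%:R + b%:R :> 'F_2.
Proof. by case: a; case: b; apply/val_inj. Qed.

Section Pivots.
Variable V : finType.
Implicit Types (G H : sgraph V) (u v x y : V) (S T : {set V}).
Implicit Types f : V -> 'F_2.

(** * Nonsingular principal submatrices *)

Definition adjact G f x : 'F_2 := \sum_y (edge G x y)%:R * f y.

(** Trivial kernel of the principal submatrix on [S], phrased with vectors on all of [V] so that
    different sets [S] share one vector space. *)
Definition nonsingular_on G S : Prop :=
  forall f, (forall x, x \notin S -> f x = 0) ->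
    (forall x, x \in S -> adjact G f x = 0) -> forall x, f x = 0.

Lemma nonsingular_on_set0 G : nonsingular_on G set0.
Proof. by move=> f f0 _ x; apply: f0; rewrite inE. Qed.

Lemma eq_nonsingular_on G H S :
  edge G =2 edge H -> nonsingular_on G S -> nonsingular_on H S.
Proof.
move=> eGH ns f f0 Af0; apply: ns => // x xS; rewrite -[RHS](Af0 x xS).
by apply: eq_bigr => y _; rewrite eGH.
Qed.

Lemma sum_delta (F : V -> 'F_2) u : \sum_y F y * (y == u)%:R = F u.
Proof.
rewrite (bigD1 u) //= eqxx mulr1 big1 ?addr0 // => y /negbTE->.
by rewrite mulr0.
Qed.

(** Restriction and extension by 0 match vectors on the subtype with vectors on [V] supported in
    [S]. [det0P] gives left kernel vectors, which are right ones by symmetry of the adjacency. *)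
Lemma gdet_induced G S : gdet (induced G S) = 1 <-> nonsingular_on G S.
Proof.
pose W := {x : V | x \in S}.
have sumS (F : V -> 'F_2) : (forall x, x \notin S -> F x = 0) ->
    \sum_(i < #|{: W}|) F (val (enum_val i)) = \sum_x F x.
  move=> F0; rewrite (reindex enum_rank) /=; last first.
    by exists enum_val => ? _; rewrite (enum_rankK, enum_valK).
  rewrite (bigID (mem S)) /= [X in _ + X]big1 // addr0.
  rewrite (reindex_omap (fun w : W => val w) insub) => [|x xS] /=; last first.
    by rewrite insubT.
  apply: eq_big => [w|w _]; last by rewrite enum_rankK.
  by rewrite (valP w) valK eqxx.
split=> [d1 f f0 Af0 | ns].
- pose w : 'rV['F_2]_#|{: W}| := \row_i f (val (enum_val i)).
  have w0 : w = 0.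
    apply/eqP/negPn/negP => wN0.
    suff: gdet (induced G S) == 0 by rewrite d1 oner_eq0.
    apply/det0P; exists w => //; apply/rowP => i; rewrite !mxE.
    rewrite -[RHS](Af0 (val (enum_val i)) (valP _)) /adjact -sumS; last first.
      by move=> x /f0->; rewrite mulr0.
    by apply: eq_bigr => j _; rewrite !mxE mulrC edge_sym.
  move=> x; have [xS|/f0//] := boolP (x \in S).
  have /rowP/(_ (enum_rank (Sub x xS : W))) := w0.
  by rewrite !mxE enum_rankK.
- case: (F2_cases (gdet (induced G S))) => // /eqP/det0P[w wN0 wA0].
  case/eqP: wN0; apply/rowP => i; rewrite mxE.
  pose f x := if insub x is Some z then w 0 (enum_rank (z : W)) else 0.
  have fE j : f (val (enum_val j)) = w 0 j by rewrite /f valK enum_valK.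
  rewrite -fE; apply: ns => [x xS|x xS]; first by rewrite /f insubN.
  have /rowP/(_ (enum_rank (Sub x xS : W))) := wA0.
  rewrite !mxE => <-; rewrite /adjact -sumS => [|y yS]; last first.
    by rewrite /f insubN // mulr0.
  by apply: eq_bigr => j _; rewrite fE !mxE enum_rankK mulrC edge_sym.
Qed.

(** * Closed neighbourhoods under a pivot *)

Lemma in_cl_nbhd G x y : (y \in cl_nbhd G x) = (y == x) (+) edge G x y.
Proof.
by rewrite !inE; case: (y =P x) => [->|_] //; rewrite edge_irr.
Qed.

(* Two vectors of GF(2)^2 are distinct and both nonzero iff their
   determinant is 1. *)
Lemma toggledE G u v x y :
  toggled G u v x y = (x \in cl_nbhd G u) && (y \in cl_nbhd G v)
                  (+) (x \in cl_nbhd G v) && (y \in cl_nbhd G u).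
Proof.
have ex3 (p : pred 'I_3) : [exists i, p i] =
    [|| p (inord 0), p (inord 1) | p (inord 2)].
  apply/existsP/or3P => [[i pi]|[] pi]; [|by eexists; exact: pi ..].
  case: i pi => [[|[|[|//]]] hi] pi; [apply: Or31|apply: Or32|apply: Or33];
    by rewrite (_ : inord _ = Ordinal hi) //; apply: val_inj; rewrite /= inordK.
rewrite /toggled !ex3 /pivot_class !(tnth_nth set0) -!val_eqE /= !inordK //=.
rewrite !in_setD !in_setI.
by do 4![case: (_ \in cl_nbhd _ _)].
Qed.

(** Both [u] and [v] lie in V_3, so exactly the vertices of V_1 and V_2 have their adjacency to [u]
    and to [v] toggled. *)
Lemma cl_nbhd_pivot G u v x : edge G u v ->
  (x \in cl_nbhd (pivot G u v) u) = (x \in cl_nbhd G v)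
  /\ (x \in cl_nbhd (pivot G u v) v) = (x \in cl_nbhd G u).
Proof.
move=> uv; have vu : edge G v u by rewrite edge_sym.
have uNv : (u == v) = false by apply: contraTF uv => /eqP->; rewrite edge_irr.
rewrite !in_cl_nbhd /= /pivot_edge !toggledE !in_cl_nbhd !eqxx !edge_irr uv vu.
rewrite [v == u]eq_sym uNv.
by rewrite !addbT !addbF /=; split;
  case: (x == u); case: (x == v); case: (edge G u x); case: (edge G v x).
Qed.

Lemma pivot_edge_uv G u v : edge G u v -> edge (pivot G u v) u v.
Proof.
move=> uv; have vNu : v != u by apply: contraTneq uv => ->; rewrite edge_irr.
have [] := cl_nbhd_pivot v uv.
by rewrite !in_cl_nbhd (negbTE vNu) eqxx edge_irr.
Qed.

(** The toggling rule is symmetric in the two closed neighbourhoods, which the first pivot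
    exchanges; the second one thus toggles the same pairs. *)
Lemma pivotK G u v : edge G u v ->
  edge (pivot (pivot G u v) u v) =2 edge G.
Proof.
move=> uv x y; have [xu xv] := cl_nbhd_pivot x uv.
have [yu yv] := cl_nbhd_pivot y uv.
rewrite /= /pivot_edge toggledE xu xv yu yv /= /pivot_edge toggledE.
by rewrite [X in _ (+) X]addbC addbK.
Qed.

(** * The exchange of coordinates *)

Lemma sum_cl_nbhd G f u :
  \sum_y (y \in cl_nbhd G u)%:R * f y = f u + adjact G f u.
Proof.
rewrite /adjact -(sum_delta f u) -big_split; apply: eq_bigr => y _ /=.
by rewrite in_cl_nbhd F2_addb mulrDl [f y * _]mulrC.
Qed.

(** By [toggledE], the pivot adds a b^T + b a^T to the adjacency matrix, where a and b are the
    indicator vectors of N'(u) and N'(v). *)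
Lemma adjact_pivot G u v f x :
  adjact (pivot G u v) f x = adjact G f x
    + (x \in cl_nbhd G u)%:R * (f v + adjact G f v)
    + (x \in cl_nbhd G v)%:R * (f u + adjact G f u).
Proof.
rewrite -!sum_cl_nbhd !mulr_sumr -!big_split; apply: eq_bigr => y _ /=.
rewrite /pivot_edge toggledE !F2_addb !mulrDl addrA !mulrA -!natrM.
by rewrite !mulnb.
Qed.

Definition swap_coords G u v f x : 'F_2 :=
  if x \in [set u; v] then adjact G f x else f x.

(** In characteristic 2, replacing f by A f at a vertex amounts to adding f + A f there. *)
Lemma adjact_swap_coords G H u v f x : u != v ->
  adjact H (swap_coords G u v f) x = adjact H f x
    + (edge H x u)%:R * (f u + adjact G f u)
    + (edge H x v)%:R * (f v + adjact G f v).
Proof.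
move=> uv.
rewrite -(sum_delta (fun y => (edge H x y)%:R * (f y + adjact G f y)) u).
rewrite -(sum_delta (fun y => (edge H x y)%:R * (f y + adjact G f y)) v).
rewrite -!big_split; apply: eq_bigr => y _ /=; rewrite /swap_coords !inE.
have [->|yu] := eqVneq y u; rewrite ?(negbTE uv) /=; last case: (y == v) => /=.
all: rewrite ?mulr0 ?mulr1 ?addr0 // mulrDr addrA.
all: by rewrite -mulrDr addrr_pchar2 ?mulr0 ?add0r.
Qed.

(** Let g be the swapped vector. Since uv is an edge, g + A g at [v] equals f + A f at [u], and vice
    versa. Off [u] and [v] the corrections of [adjact_pivot] and [adjact_swap_coords] therefore
    cancel. *)
Lemma adjact_pivot_swap G u v f : edge G u v ->
  adjact (pivot G u v) (swap_coords G u v f) =1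
  fun x => if x \in [set u; v] then f x else adjact G f x.
Proof.
move=> uv x; have vu : edge G v u by rewrite edge_sym.
have uNv : u != v by apply: contraTneq uv => ->; rewrite edge_irr.
have vNu : v != u by rewrite eq_sym.
rewrite adjact_pivot !adjact_swap_coords // uv vu !edge_irr !in_cl_nbhd.
rewrite /swap_coords !inE !eqxx orbT /= ![edge G _ x]edge_sym.
have [->|xu] := eqVneq x u; [|have [->|xv] := eqVneq x v];
  rewrite ?edge_irr ?uv ?vu ?eqxx ?(negbTE uNv) ?(negbTE vNu) /=;
  rewrite ?(mul0r, mul1r, addr0).
all: case: (F2_cases (f u)) => ->; case: (F2_cases (f v)) => ->;
  case: (F2_cases (adjact G f u)) => ->;
  case: (F2_cases (adjact G f v)) => ->; try by apply: val_inj.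
all: case: (F2_cases (adjact G f x)) => ->;
  by case: (edge G x u); case: (edge G x v); apply: val_inj.
Qed.

Lemma pivot_nonsingular G u v T : edge G u v ->
  nonsingular_on (pivot G u v) T ->
  nonsingular_on G ((T :\: [set u; v]) :|: ([set u; v] :\: T)).
Proof.
move=> uv ns f f0 Af0; have pvE := adjact_pivot_swap f uv.
have g0 : forall x, swap_coords G u v f x = 0.
  apply: ns => x xT; rewrite ?pvE /swap_coords; case: ifP => xuv.
  - by apply: Af0; rewrite in_setU !in_setD xuv xT.
  - by apply: f0; rewrite in_setU !in_setD xuv (negbTE xT).
  - by apply: f0; rewrite in_setU !in_setD xuv xT.
  - by apply: Af0; rewrite in_setU !in_setD xuv xT.
(* At [u] and [v], g = 0 only says A f = 0; there f is recovered as the image of g under the pivoted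
   matrix. *)
move=> x; case: (boolP (x \in [set u; v])) => xuv; last first.
  by rewrite -(g0 x) /swap_coords (negbTE xuv).
have := pvE x; rewrite xuv => <-.
by apply: big1 => y _; rewrite g0 mulr0.
Qed.

(** This is [pivot_nonsingular] for the pivoted graph, whose pivot on the same edge is [G] again. *)
Lemma nonsingular_pivot G u v S : edge G u v -> [set u; v] \subset S ->
  nonsingular_on G S -> nonsingular_on (pivot G u v) (S :\: [set u; v]).
Proof.
move=> uv uvS nsG; have uv' := pivot_edge_uv uv.
have /(pivot_nonsingular uv') : nonsingular_on (pivot (pivot G u v) u v) S.
  by apply: eq_nonsingular_on nsG => x y; rewrite pivotK.
by move: uvS; rewrite -setD_eq0 => /eqP->; rewrite setU0.
Qed.

(** * Sequences of pivots *)

Lemma pivot_support_cons G p phi : edge G p.1 p.2 ->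
  pivot_support (p :: phi) =
    (pivot_support phi :\: [set p.1; p.2])
      :|: ([set p.1; p.2] :\: pivot_support phi).
Proof.
move=> uv; have uNv : p.1 != p.2 by apply: contraTneq uv => ->; rewrite edge_irr.
apply/setP => x; rewrite !inE /= !oddD !oddb ![x == _]eq_sym.
have [<-|_] := eqVneq p.1 x; last by case: (_ == x); case: (odd _).
by rewrite eq_sym (negbTE uNv) /=; case: (odd _).
Qed.

Lemma applicable_nonsingular G phi :
  applicable G phi -> nonsingular_on G (pivot_support phi).
Proof.
elim: phi G => [|p phi IH] G /=.
  by move=> _; rewrite (_ : pivot_support _ = set0);
    [exact: nonsingular_on_set0 | apply/setP => x; rewrite !inE].
move=> /andP[uv /IH ns]; rewrite (pivot_support_cons _ uv).
exact: pivot_nonsingular.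
Qed.

(** Otherwise the indicator vector of [x] would be a nonzero kernel vector. *)
Lemma nonsingular_has_edge G S x : nonsingular_on G S -> x \in S ->
  exists2 y, y \in S & edge G x y.
Proof.
move=> ns xS; apply/exists_inP; apply: contraT => /exists_inPn noe.
suff /eqP: (x == x)%:R = 0 :> 'F_2 by rewrite eqxx oner_eq0.
apply: (ns (fun y => (y == x)%:R)) => [y|y yS].
  by case: eqP => // ->; rewrite xS.
rewrite /adjact sum_delta edge_sym.
by rewrite (negbTE (noe y yS)).
Qed.

Lemma nonsingular_applicable G S : nonsingular_on G S ->
  exists phi : seq (V * V),
    [/\ pivot_support phi = S, applicable G phi & reduced phi].
Proof.
have [n] := ubnP #|S|; elim: n G S => // n IH G S; rewrite ltnS => leSn ns.
have [->|[x xS]] := set_0Vmem S.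
  by exists [::]; split=> //; apply/setP => x; rewrite !inE.
have [y yS xy] := nonsingular_has_edge ns xS.
have xNy : x != y by apply: contraTneq xy => ->; rewrite edge_irr.
have xyS : [set x; y] \subset S by apply/subsetP => z /set2P[]->.
have [|phi [sphi aphi rphi]] := IH _ _ _ (nonsingular_pivot xy xyS ns).
  apply: leq_trans leSn; rewrite cardsD (setIidPr xyS) cards2 xNy.
  by rewrite -[ltnRHS]subn0 ltn_sub2l // (cardsD1 x) xS.
(* As [phi] is reduced, each of its vertices occurs once and so lies in its support, which avoids
   [x] and [y]; prepending the pair keeps the sequence reduced. *)
have sub z : z \in pivot_vertices phi -> z \in S :\: [set x; y].
  by rewrite -sphi inE count_uniq_mem // => ->.
exists ((x, y) :: phi); split; rewrite /= ?xy //.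
  rewrite (pivot_support_cons _ (xy : edge G (x, y).1 (x, y).2)) sphi /=.
  apply/setP => z; rewrite !inE; move/subsetP/(_ z): xyS; rewrite !inE.
  by case: (_ || _) => [->|_] //=; case: (z \in S).
rewrite /reduced /= inE negb_or xNy -andbA /=; apply/and3P; split=> //.
  by apply/negP => /sub; rewrite !inE eqxx.
by apply/negP => /sub; rewrite !inE eqxx orbT.
Qed.

End Pivots.

Theorem theorem6 (V : finType) (G : sgraph V) (S : {set V}) :
  (gdet (induced G S) = 1 <->
     exists phi : seq (V * V), pivot_support phi = S /\ applicable G phi)
  /\
  (gdet (induced G S) = 1 ->
     exists phi : seq (V * V),
       [/\ pivot_support phi = S, applicable G phi & reduced phi]).
Proof.
have dir : gdet (induced G S) = 1 -> exists phi : seq (V * V),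
    [/\ pivot_support phi = S, applicable G phi & reduced phi].
  by move=> /gdet_induced; apply: nonsingular_applicable.
split=> //; split=> [/dir[phi [<- ? _]]|[phi [<- ap]]]; first by exists phi.
by apply/gdet_induced/applicable_nonsingular.
Qed.
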